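(* Let $a\in\mathbb N$, $z\in\{1,\dots,a-1\}$, $p\in(0,1)$, $q=1-p$ and $\gamma\in(0,1)$. The ruin probability $q_z(\gamma)$ of the random walk on $\{0,1,\dots,a\}$ with geometric resetting to $z$ with parameter $\gamma$ satisfies $$q_z(\gamma)=\frac{\mathbb E_z\!\left[(1-\gamma)^{\tau_0}\,\mathbf 1_{\{\tau_0<\tau_a\}}\right]}{\mathbb E_z\!\left[(1-\gamma)^{\tau}\right]},$$ where $\tau_0$, $\tau_a$ and $\tau=\min\{\tau_0,\tau_a\}$ are the hitting times of $0$, of $a$, and of $\{0,a\}$ for the underlying random walk without resetting started at $z$.
   Context: The process with resetting: $(X_n)_{n\ge0}$ on $\{0,1,\dots,a\}$ starts at $X_0=z$. At each time step, independently of everything else, with probability $\gamma$ the walker is reset, $X_n=z$ (the same $z$ as the starting position), and with probability $1-\gamma$ it performs a step $X_n=X_{n-1}+\xi_n$, where $(\xi_n)$ are i.i.d. with $\mathbb P(\xi_n=+1)=p$, $\mathbb P(\xi_n=-1)=q$. Thus the times between successive resets are i.i.d. geometric: $\mathbb P(\sigma=k)=\gamma(1-\gamma)^{k-1}$, $k\ge1$. The process is absorbed upon first hitting $0$ or $a$. The ruin probability $q_z(\gamma)$ is the probability that the process started from (and reset to) $z$ is absorbed at $0$ before reaching $a$. The underlying walk without resetting is $Y_0=z$, $Y_n=Y_{n-1}+\xi_n$, absorbed at $0$ and $a$; $\mathbb E_z$ denotes expectation for it, $\tau_0=\inf\{n\ge1:Y_n=0\}$, $\tau_a=\inf\{n\ge1:Y_n=a\}$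 (with $\inf\emptyset=\infty$), and $\tau=\min\{\tau_0,\tau_a\}$. *)

(* Defs.v *)
From HB Require Import structures.
From mathcomp Require Import all_boot all_order all_algebra.
From mathcomp Require Import finmap.
From mathcomp Require Import all_classical all_reals all_analysis.

Set Implicit Arguments.
Unset Strict Implicit.
Unset Printing Implicit Defensive.

Import Order.TTheory GRing.Theory Num.Theory.
Import numFieldNormedType.Exports.

Local Open Scope classical_set_scope.
Local Open Scope ring_scope.

Section independence.
Context {d : measure_display} {T : measurableType d} {R : realType}.

(* Mutual independence of a (possibly infinite) family of sigma-algebras on T:
   the product rule over every finite subfamily. *)
Definition mutually_independent (P : probability T R) (I : choiceType)
    (F : I -> set (set T)) : Prop :=
  forall (J : {fset I}) (A : I -> set T),
    (forall i, i \in J -> F i (A i)) ->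
    (P (\bigcap_(i in [set` J]) A i) = \prod_(i <- J) P (A i))%E.

Definition sigma_generated d' (U : measurableType d') (f : T -> U) :
    set (set T) :=
  preimage_set_system setT f measurable.

(* All step variables (left indices) and all reset decisions (right indices)
   taken together as one family. *)
Definition steps_and_resets (xi : nat -> T -> R) (rho : nat -> T -> bool)
    (i : nat + nat) : set (set T) :=
  match i with
  | inl n => sigma_generated (xi n)
  | inr n => sigma_generated (rho n)
  end.

End independence.

Section walks.
Context {T : Type} {R : realType}.

Definition absorbing (a : nat) (x : R) : bool := (x == 0) || (x == a%:R).

(* Index shift: xi n and rho n drive time step n.+1, so that xi n is the
   increment usually written xi_(n+1). *)

(* Y : the walk without resetting, absorbed at 0 and a. *)
Fixpoint walk (xi : nat -> T -> R) (a z n : nat) (w : T) : R :=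
  if n is m.+1 then
    let y := walk xi a z m w in
    if absorbing a y then y else y + xi m w
  else z%:R.

(* X : the walk reset to its starting point z whenever rho holds, absorbed at
   0 and a. *)
Fixpoint reset_walk (xi : nat -> T -> R) (rho : nat -> T -> bool)
    (a z n : nat) (w : T) : R :=
  if n is m.+1 then
    let x := reset_walk xi rho a z m w in
    if absorbing a x then x
    else if rho m w then z%:R
    else x + xi m w
  else z%:R.

(* inf {n >= 1 | Z_n = x}; the infimum of the empty set is +oo. *)
Definition hitting_time (Z : nat -> T -> R) (x : R) (w : T) : \bar R :=
  ereal_inf [set (n%:R)%:E | n in [set n : nat | (0 < n)%N /\ Z n w = x]].

(* s ^ t for 0 < s < 1 and t in [0, +oo], with s ^ +oo = 0; the value at -oo
   is irrelevant. *)
Definition discount (s : R) (t : \bar R) : R :=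
  if t is r%:E then s `^ r else 0.

End walks.

Definition ruin_probability {d : measure_display} {T : measurableType d}
    {R : realType} (P : probability T R)
    (xi : nat -> T -> R) (rho : nat -> T -> bool) (a z : nat) : \bar R :=
  let X := reset_walk xi rho a z in
  P [set w | (hitting_time X 0 w < hitting_time X a%:R w)%E].

(* Main.v *)
Require Import Defs.
From HB Require Import structures.
From mathcomp Require Import all_boot all_order all_algebra finmap.
From mathcomp Require Import all_classical all_reals all_analysis.
From mathcomp Require Import measurable_realfun ring lra.

Import Order.TTheory GRing.Theory Num.Theory.
Import numFieldNormedType.Exports.

Local Open Scope classical_set_scope.
Local Open Scope ring_scope.

(* Write s = 1 - gamma. The expected numbers of visits V of the walk with
   resetting and the discounted expected numbers of visits U of the plain walk,
   restricted to the sites 0 < x < a, solve the same linear system up to a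
   factor c in the source at z; since s < 1 its solution is unique, so V = c U.
   Reading off the flux into 0 and into a, resetting is absorbed at y with
   probability c F_y, where F_y is the expectation of s^tau_y on
   tau_y < tau_(a-y). The walk with resetting is absorbed almost surely, because
   V is finite, so c (F_0 + F_a) = 1 and q_z = c F_0 = F_0 / (F_0 + F_a). *)

(** * Occupation measures *)

Lemma cvg_fin_sum {R : realType} (E : finType) (A : pred E)
    (f : E -> nat -> R) (l : E -> R) :
  (forall x, A x -> f x n @[n --> \oo] --> l x) ->
  (\sum_(x | A x) f x n) @[n --> \oo] --> \sum_(x | A x) l x.
Proof. by move=> fl; apply: cvg_big => //; exact: add_continuous. Qed.

(** Summing a one-step recursion over time gives a linear relation between the total masses, since
    the finite sum over sites commutes with the series; the term [g 0] is the source. Used both for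
    balance at interior sites and for the flux into an absorbing site. *)
Lemma cvg_series_transfer {R : realType} (E : finType) (A : pred E)
    (w : nat -> E -> R) (W m : E -> R) (g : nat -> R) :
  (forall n, g n.+1 = \sum_(x | A x) w n x * m x) ->
  (forall x, A x -> series (w ^~ x) n @[n --> \oo] --> W x) ->
  series g n @[n --> \oo] --> g 0%N + \sum_(x | A x) W x * m x.
Proof.
move=> gS wW; rewrite -(cvg_shiftS (series g)).
have -> : [sequence series g n.+1]_n =
    (fun n => g 0%N + \sum_(x | A x) series (w ^~ x) n * m x).
  apply/funext => n /=; rewrite /series /= big_nat_recl //; congr (_ + _).
  under eq_bigr do rewrite gS.
  by rewrite exchange_big; apply: eq_bigr => x _; rewrite mulr_suml.
apply: cvgD; first exact: cvg_cst.
by apply: cvg_fin_sum => x Ax; apply: cvgMl; exact: wW.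
Qed.

(** Contraction in the l1 norm: as [K] is substochastic, the norm [S] of [D] satisfies [S <= s * S],
    which with [s < 1] forces [S = 0]. *)
Lemma discounted_fixpoint_eq0 {R : realType} (E : finType) (A : pred E)
    (K : E -> E -> R) (s : R) (D : E -> R) :
  0 <= s < 1 -> (forall x y, 0 <= K x y) ->
  (forall x, \sum_(y | A y) K x y <= 1) ->
  (forall y, A y -> D y = s * \sum_(x | A x) D x * K x y) ->
  forall y, A y -> D y = 0.
Proof.
move=> /andP[s0 s1] K0 K1 fixD.
set S := \sum_(y | A y) `|D y|.
have S0 : 0 <= S by apply: sumr_ge0.
have leS : S <= s * S.
  have : S <= \sum_(y | A y) s * \sum_(x | A x) `|D x| * K x y.
    apply: ler_sum => y Ay; rewrite {1}fixD // normrM (ger0_norm s0).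
    apply: ler_wpM2l => //; apply: le_trans (ler_norm_sum _ _ _) _.
    by apply: ler_sum => x _; rewrite normrM (ger0_norm (K0 _ _)).
  move=> /le_trans; apply; rewrite -mulr_sumr ler_wpM2l //.
  rewrite exchange_big; apply: ler_sum => x _.
  by rewrite -mulr_sumr ler_piMr.
have {leS S0} S0 : S = 0 by nra.
move=> y Ay; apply/eqP; rewrite -normr_eq0 eq_le normr_ge0 andbT -S0.
by rewrite /S (bigD1 y) //= lerDl sumr_ge0.
Qed.

(* Both occupation measures solve W = c [z] + s W K: c = 1 for the discounted
   one, and for v the constant c counts the visits to z that are not the outcome
   of a step, namely the start and all resets. *)
Lemma reset_occupation {R : realType} (E : finType) (A : pred E)
    (K : E -> E -> R) (s : R) (z : E) (u v : nat -> E -> R) :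
  A z -> 0 <= s < 1 -> (forall x y, 0 <= K x y) ->
  (forall x, \sum_(y | A y) K x y <= 1) ->
  (forall y, u 0%N y = (y == z)%:R) -> (forall y, v 0%N y = (y == z)%:R) ->
  (forall n y, A y -> u n.+1 y = \sum_(x | A x) u n x * K x y) ->
  (forall n y, A y ->
     v n.+1 y = \sum_(x | A x) v n x * (s * K x y + (1 - s) * (y == z)%:R)) ->
  (forall n x, 0 <= u n x <= 1) -> (forall n x, 0 <= v n x) ->
  (forall x, A x -> cvgn (series (v ^~ x))) ->
  exists (c : R) (U : E -> R), [/\ 0 < c,
    forall x, A x -> series (fun n => s ^+ n * u n x) n @[n --> \oo] --> U x &
    forall x, A x -> series (v ^~ x) n @[n --> \oo] --> c * U x].
Proof.
move=> Az s01 K0 K1 u0 v0 uS vS u01 v_ge0 cv.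
have /andP[s0 s1] := s01.
(* Dominated by the geometric series of ratio [s], because [u n x <= 1]. *)
have cu x : cvgn (series (fun n => s ^+ n * u n x)).
  apply: (@series_le_cvg _ _ (geometric 1 s)) => [n|n|n|].
  - by have /andP[? ?] := u01 n x; rewrite mulr_ge0 ?exprn_ge0.
  - by rewrite /= mul1r exprn_ge0.
  - have /andP[? ?] := u01 n x.
    by rewrite /= mul1r ler_piMr ?exprn_ge0.
  - by apply: is_cvg_geometric_series; rewrite ger0_norm.
pose U x : R := limn (series (fun n => s ^+ n * u n x)).
pose V x : R := limn (series (v ^~ x)).
have V_ge0 x : A x -> 0 <= V x.
  move=> Ax; apply: limr_ge; first exact: cv.
  by near=> n; apply: sumr_ge0 => i _.
pose c : R := 1 + (1 - s) * \sum_(x | A x) V x.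
have c0 : 0 < c.
  by rewrite ltr_wpDr // mulr_ge0 ?subr_ge0 ?(ltW s1) // sumr_ge0.
exists c, U; split => [//|x _|x Ax]; first exact: (cu x).
have UE y : A y -> U y = (y == z)%:R + s * \sum_(x | A x) U x * K x y.
  move=> Ay; rewrite mulr_sumr; apply/cvg_lim => //.
  have := @cvg_series_transfer R E A (fun n x => s ^+ n * u n x) U
    (fun x => s * K x y) (fun n => s ^+ n * u n y).
  rewrite expr0 mul1r u0; under [X in _ + X]eq_bigr do rewrite mulrCA.
  apply=> [n|x' _]; last exact: (cu x').
  by rewrite uS // exprS mulr_sumr; apply: eq_bigr => i _; ring.
have VE y : A y -> V y = c * (y == z)%:R + s * \sum_(x | A x) V x * K x y.
  move=> Ay.
  have -> : c * (y == z)%:R + s * \sum_(x | A x) V x * K x y = v 0%N y +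
      \sum_(x | A x) V x * (s * K x y + (1 - s) * (y == z)%:R).
    rewrite v0 /c mulrDl mul1r -addrA; congr (_ + _).
    rewrite !mulr_sumr mulr_suml -big_split /=.
    by apply: eq_bigr => i _; ring.
  apply/cvg_lim => //; apply: cvg_series_transfer => [n|x' Ax'].
    exact: vS.
  exact: (cv x' Ax').
(* The sources at [z] cancel in [V - c U], which leaves the homogeneous equation. *)
have D0 y : A y -> V y - c * U y = 0.
  apply: (@discounted_fixpoint_eq0 _ _ A K s (fun y => V y - c * U y) s01 K0 K1).
  move=> {}y Ay; rewrite VE // (UE y) //.
  under [in RHS]eq_bigr do rewrite mulrBl -mulrA.
  by rewrite sumrB -mulr_sumr; ring.
by rewrite -(subr0_eq (D0 x Ax)); exact: (cv x Ax).
Unshelve. all: by end_near. Qed.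
(** * Finite chains driven by independent outcomes *)

Lemma measure_fin_partition {d : measure_display} {T : measurableType d}
    {R : realType} (P : probability T R) (E : finType) (Z : T -> E) (A : set T) :
  measurable A -> (forall x, measurable [set w | Z w = x]) ->
  (P A = \sum_x P (A `&` [set w | Z w = x]))%E.
Proof.
move=> mA mZ.
rewrite fsbig_seq ?index_enum_uniq // -measure_fin_bigcup //.
- congr (P _); apply/seteqP; split=> w /=; last by move=> [x _ []].
  by move=> Aw; exists (Z w) => //=; rewrite mem_index_enum.
- by move=> x y _ _ [w [[_ /= <-] [_ /= <-]]].
- by move=> x _; apply: measurableI.
Qed.

Section driven_chain_def.
Context {T : Type} {R : realType} {O E : finType}.
Variables (o : nat -> T -> O) (pi : O -> R) (F : E -> O -> E) (z : E).

Fixpoint cylinder (n : nat) (e : seq O) : set T :=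
  if e is c :: e' then [set w | o n w = c] `&` cylinder n.+1 e' else setT.

Fixpoint chain (n : nat) (w : T) : E :=
  if n is m.+1 then F (chain m w) (o m w) else z.

Fixpoint chain_law (n : nat) (y : E) : R :=
  if n is m.+1 then
    \sum_x chain_law m x * \sum_c pi c * (F x c == y)%:R
  else (y == z)%:R.

End driven_chain_def.

Section driven_chain.
Context {d : measure_display} {T : measurableType d} {R : realType}.
Context {O E : finType}.
Variables (P : probability T R) (o : nat -> T -> O).
Variables (pi : O -> R) (F : E -> O -> E) (z : E).
Local Notation cylinder := (cylinder o).
Local Notation chain := (chain o F z).
Local Notation chain_law := (chain_law pi F z).

Hypothesis mo : forall n c, measurable [set w | o n w = c].

Lemma measurable_cylinder n e : measurable (cylinder n e).
Proof.
by elim: e n => [|c e IHe] n; [exact: measurableT|apply: measurableI].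
Qed.

Lemma measurable_chain n y : measurable [set w | chain n w = y].
Proof.
elim: n y => [|n IHn] y /=.
  have [<-|zy] := eqVneq z y.
    by rewrite (_ : [set _ | _] = setT) //; apply/seteqP.
  rewrite (_ : [set _ | _] = set0) //; apply/seteqP; split=> // w /=.
  by move/eqP; rewrite (negbTE zy).
rewrite (_ : [set _ | _] = \bigcup_(xc in [set xc : E * O | F xc.1 xc.2 = y])
    ([set w | chain n w = xc.1] `&` [set w | o n w = xc.2])).
  apply: fin_bigcup_measurable; first exact: finite_finset.
  by move=> xc _; apply: measurableI.
apply/seteqP; split=> w /=.
  by move=> Fy; exists (chain n w, o n w).
by move=> [[x c] /= <- [<- <-]].
Qed.

Hypothesis cylinderP :
  forall e, P (cylinder 0 e) = (\prod_(c <- e) pi c)%:E.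

(** Strengthened for the induction by a word [e] of future outcomes: the step splits on the state
    and the outcome at time [n], and prepends that outcome to [e]. Thus the product formula for
    cylinders starting at time 0 is the only form of independence that enters. *)
Lemma chain_cylinder n y e :
  P ([set w | chain n w = y] `&` cylinder n e) =
  (chain_law n y * \prod_(c <- e) pi c)%:E.
Proof.
elim: n y e => [|n IHn] y e /=.
  rewrite [y == z]eq_sym; have [<-|zy] := eqVneq z y.
    rewrite (_ : [set _ | _] = setT) ?setTI ?mul1r //.
    by apply/seteqP.
  rewrite (_ : [set _ | _] = set0) ?set0I ?measure0 ?mul0r //.
  apply/seteqP; split=> // w /= /eqP; by rewrite (negbTE zy).
rewrite (@measure_fin_partition _ _ _ P _ (fun w => (chain n w, o n w))).
- transitivity (\sum_(xc : E * O)
      (chain_law n xc.1 * (pi xc.2 * (F xc.1 xc.2 == y)%:R)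
       * \prod_(c <- e) pi c)%:E)%E.
    apply: eq_bigr => -[x c] _ /=.
    have [Fy|Fy] := eqVneq (F x c) y.
      rewrite mulr1 -mulrA -(big_cons _ _ c e xpredT pi) -IHn.
      congr (P _); apply/seteqP; split=> w /=; first by case=> -[_ ?] [<- <-].
      by case=> cw [ow ?]; rewrite cw ow.
    rewrite !mulr0 mul0r.
    rewrite (_ : _ `&` _ = set0) ?measure0 //; apply/seteqP; split=> // w /=.
    by case=> -[Fw _] [cx oc]; move/eqP: Fy; apply; rewrite -cx -oc.
  rewrite sumEFin -mulr_suml; congr (_ * _)%:E.
  rewrite -(pair_bigA _ (fun x c =>
    chain_law n x * (pi c * (F x c == y)%:R))) /=.
  by apply: eq_bigr => x _; rewrite mulr_sumr.
- by apply: measurableI; [exact: (measurable_chain n.+1)|exact: measurable_cylinder].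
- move=> [x c]; rewrite (_ : [set _ | _] =
    [set w | chain n w = x] `&` [set w | o n w = c]).
    by apply: measurableI => //; exact: measurable_chain.
  by apply/seteqP; split=> w /= [-> ->].
Qed.

Lemma chain_lawE n y : P [set w | chain n w = y] = (chain_law n y)%:E.
Proof. by have := chain_cylinder n y [::]; rewrite /= setIT big_nil mulr1. Qed.

Lemma sum_chain_law n : \sum_y chain_law n y = 1.
Proof.
apply: EFin_inj; rewrite -sumEFin -(probability_setT P).
rewrite (@measure_fin_partition _ _ _ P _ (chain n) setT) //; last first.
  by move=> x; exact: measurable_chain.
by apply: eq_bigr => x _; rewrite setTI chain_lawE.
Qed.

End driven_chain.

Lemma mutually_independent_seq {d : measure_display} {T : measurableType d}
    {R : realType} (P : probability T R) (I : choiceType)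
    (F : I -> set (set T)) (s : seq I) (A : I -> set T) :
  mutually_independent P F -> uniq s -> (forall i, i \in s -> F i (A i)) ->
  (P (\big[setI/setT]_(i <- s) A i) = \prod_(i <- s) P (A i))%E.
Proof.
move=> indep us FA; have eqs : perm_eq [fset i in s]%fset s.
  by apply: uniq_perm => // i; rewrite inE.
rewrite -!(perm_big _ eqs) /= -bigcap_fset; apply: indep => i.
by rewrite inE; exact: FA.
Qed.
(** * Entry times and discounting *)

Lemma ereal_inf_setU {R : realType} (A B : set (\bar R)) :
  ereal_inf (A `|` B) = Order.min (ereal_inf A) (ereal_inf B).
Proof.
apply/eqP; rewrite eq_le le_min -andbA; apply/and3P; split.
- by apply: ereal_inf_le_tmp => x; left.
- by apply: ereal_inf_le_tmp => x; right.
- apply: le_ereal_inf_tmp => x [Ax|Bx]; rewrite ge_min; apply/orP.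
    by left; exact: ereal_inf_lbound.
  by right; exact: ereal_inf_lbound.
Qed.

Lemma eseries_single {R : realType} (f : nat -> \bar R) (m : nat) :
  (forall n, n != m -> f n = 0%E) -> (\sum_(0 <= n <oo) f n)%E = f m.
Proof.
move=> f0; apply/cvg_lim => //; apply: cvg_near_cst; near=> n.
rewrite (bigD1_seq m) ?iota_uniq //=; last first.
  by rewrite mem_index_iota /=; near: n; exact: nbhs_infty_gt.
by rewrite big1 ?adde0.
Unshelve. all: by end_near. Qed.

(** Phrased for a predicate of time, so that the hitting time of one site and the absorption time
    [tau] are both instances. *)
Definition entry_time {R : realType} (B : nat -> bool) : \bar R :=
  ereal_inf [set (n%:R)%:E | n in [set n : nat | (0 < n)%N /\ B n]].

(** Once true, [B] stays true, so at most one term of the series is nonzero: the one at which [B]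
    switches on. If [B] never holds, the time is [+oo] and both sides are 0. *)
Lemma discount_entry_time {R : realType} (s : R) (B : nat -> bool) :
  0 <= s -> (forall n, B n -> B n.+1) -> ~~ B 0%N ->
  (discount s (entry_time B))%:E =
  (\sum_(0 <= n <oo) (s ^+ n.+1 * (B n.+1 && ~~ B n)%:R)%:E)%E.
Proof.
move=> s0 BS B0.
have Bmono m n : (m <= n)%N -> B m -> B n.
  move=> /subnKC <-; elim: (n - m)%N => [|k IHk]; first by rewrite addn0.
  by rewrite addnS => /IHk/BS.
have [[n Bn]|noB] := pselect (exists n, B n); last first.
  have nB n : B n = false by apply/negP => Bn; apply: noB; exists n.
  have -> : entry_time B = +oo%E :> \bar R.
    by apply/ereal_inf_pinfty => x [n [_]]; rewrite nB.
  by rewrite /= eseries0 // => n _ _; rewrite nB mulr0.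
have exB : exists n, B n by exists n.
have [[|m] Bm minm] := ex_minnP exB; first by rewrite Bm in B0.
have nBm : ~~ B m by apply/negP => /minm; rewrite ltnn.
have -> : entry_time B = (m.+1%:R)%:E :> \bar R.
  apply/eqP; rewrite eq_le; apply/andP; split.
    by apply: ereal_inf_lbound; exists m.+1.
  apply: le_ereal_inf_tmp => _ [k [_ /minm mk] <-].
  by rewrite lee_fin ler_nat.
rewrite (@eseries_single _ _ m) => [|k km].
  by rewrite Bm nBm mulr1 /discount powR_mulrn.
rewrite [_ && _](_ : _ = false) ?mulr0 //; apply/negP => /andP[BkS nBk].
have mk := minm _ BkS; move: km; rewrite neq_ltn => /orP[km|mk'].
  by rewrite ltnS leqNgt km in mk.
by rewrite (Bmono m.+1 k) in nBk.
Qed.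

(** The series of [discount_entry_time] has nonnegative terms and is integrated term by term; by
    monotonicity of [B], entry at time [n.+1] has probability [b n.+1 - b n]. *)
Lemma expectation_discount_entry_time {d : measure_display}
    {T : measurableType d} {R : realType} (P : probability T R) (s : R)
    (B : T -> nat -> bool) (b : nat -> R) (l : R) :
  0 <= s -> (forall n, measurable [set w | B w n]) ->
  (forall w n, B w n -> B w n.+1) -> (forall w, ~~ B w 0%N) ->
  (forall n, P [set w | B w n] = (b n)%:E) ->
  series (fun n => s ^+ n.+1 * (b n.+1 - b n)) n @[n --> \oo] --> l ->
  'E_P[fun w => discount s (entry_time (B w))]%E = l%:E.
Proof.
move=> s0 mB BS B0 Pb bl.
pose D n := [set w | B w n.+1] `\` [set w | B w n].
have mD n : measurable (D n) by apply: measurableD.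
rewrite unlock; transitivity
    (\int[P]_w \sum_(0 <= n <oo) ((s ^+ n.+1)%:E * (\1_(D n) w)%:E))%E.
  apply: eq_integral => w _; rewrite discount_entry_time //; last exact: BS.
  apply: eq_eseriesr => n _; rewrite EFinM indicE; congr (_ * (_%:R)%:E)%E.
  congr nat_of_bool.
  by apply/idP/idP => [/andP[H1 /negP H2]|]; rewrite inE // => -[/= -> /negP].
rewrite integral_nneseries //; last 2 first.
- move=> n; apply: measurable_funeM.
  by apply/measurable_EFinP; exact: measurable_indic.
- by move=> n w _; rewrite mule_ge0 ?lee_fin ?exprn_ge0.
have intD n : (\int[P]_w ((s ^+ n.+1)%:E * (\1_(D n) w)%:E) =
    (s ^+ n.+1 * (b n.+1 - b n))%:E)%E.
  rewrite ge0_integralZl_EFin ?exprn_ge0 //; last first.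
    by apply/measurable_EFinP; exact: measurable_indic.
  rewrite integral_indic // setIT EFinM; congr (_ * _)%E.
  have BI : [set w | B w n.+1] `&` [set w | B w n] = [set w | B w n].
    by apply/seteqP; split=> w /= => [[]|Bn] //; split=> //; exact: BS.
  rewrite EFinB -!Pb measureD // ?BI //.
  by rewrite ltey_eq fin_num_measure.
rewrite (eq_eseriesr (fun n _ => intD n)); apply/cvg_lim => //.
under eq_cvg do rewrite sumEFin.
by apply: cvg_EFin => //; exact: nearW.
Qed.

(** Adding a measurable null set that covers [N] makes the two sets equal. Needed because the steps
    are [1] or [- 1] only almost surely. *)
Lemma measure_eq_outside_negligible {d : measure_display} {T : measurableType d}
    {R : realType} (P : probability T R) (N A B : set T) :
  P.-negligible N -> measurable A -> measurable B ->
  (forall w, ~ N w -> A w <-> B w) -> P A = P B.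
Proof.
move=> [M [mM M0 NM]] mA mB AB.
rewrite -(measureU0 mA mM M0) -(measureU0 mB mM M0); congr (P _).
apply/seteqP; split=> w [Hw|]; try by right.
  by have [Mw|Mw] := pselect (M w); [right|left; apply/AB => // /NM].
by have [Mw|Mw] := pselect (M w); [right|left; apply/AB => // /NM].
Qed.

(** Lets the path lemmas below serve both walks. *)
Lemma walkE {T : Type} {R : realType} (xi : nat -> T -> R) (a z : nat) :
  walk xi a z = reset_walk xi (fun _ _ => false) a z.
Proof. by apply/funext => n; apply/funext => w; elim: n => //= n ->. Qed.

Section reset_walk_paths.
Context {T : Type} {R : realType}.
Variables (xi : nat -> T -> R) (rho : nat -> T -> bool) (a z : nat).
Hypothesis hz : (0 < z < a)%N.
Local Notation X := (reset_walk xi rho a z).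

Lemma absorbing_start : ~~ absorbing a (z%:R : R).
Proof.
have /andP[z0 za] := hz.
by rewrite /absorbing negb_or pnatr_eq0 -lt0n z0 eqr_nat neq_ltn za.
Qed.

Lemma reset_walk_absorbed m n w :
  (m <= n)%N -> absorbing a (X m w) -> X n w = X m w.
Proof.
move=> /subnKC <-; elim: (n - m)%N => [|k IHk]; first by rewrite addn0.
by move=> abs; rewrite addnS /= IHk // abs.
Qed.

Lemma reset_walk_stay (x : R) w n :
  absorbing a x -> X n w == x -> X n.+1 w == x.
Proof. by move=> ax /eqP Xx; rewrite (@reset_walk_absorbed n) ?Xx. Qed.

Lemma hitting_time_entry (x : R) w :
  hitting_time X x w = entry_time (fun n => X n w == x).
Proof.
congr ereal_inf; apply/seteqP; split=> _ [n [n0 Xn] <-]; exists n => //.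
  by split=> //; exact/eqP.
by split=> //; exact/eqP.
Qed.

Lemma min_hitting_time_entry w :
  Order.min (hitting_time X 0 w) (hitting_time X a%:R w) =
  entry_time (fun n => absorbing a (X n w)).
Proof.
rewrite -ereal_inf_setU -image_setU; congr ereal_inf; congr image.
apply/seteqP; split=> n /= => [[[n0 /eqP Xn]|[n0 /eqP Xn]]|].
- by split=> //; rewrite /absorbing Xn.
- by split=> //; rewrite /absorbing Xn orbT.
- by case=> n0 /orP[/eqP ?|/eqP ?]; [left|right].
Qed.

Lemma hitting_timeNy (x : R) w :
  (forall n, X n w <> x) -> hitting_time X x w = +oo%E.
Proof. by move=> nX; apply/ereal_inf_pinfty => y [n [_ /nX]]. Qed.

(** An absorbed walk visits at most one of the two sites, so reaching [x] first means reaching it at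
    all. The start is not absorbing, hence such a visit has a positive time index, as [hitting_time]
    requires. *)
Lemma hitting_time_lt (x y : R) : absorbing a x -> absorbing a y -> x != y ->
  [set w | (hitting_time X x w < hitting_time X y w)%E] =
  \bigcup_n [set w | X n w = x].
Proof.
move=> ax ay xy; apply/seteqP; split=> w /=.
  move=> ltxy; apply: contrapT => nX; move: ltxy.
  rewrite hitting_timeNy ?ltNge ?leey // => n Xn.
  by apply: nX; exists n.
move=> [n _ /= Xn].
have n0 : (0 < n)%N.
  by case: n Xn => //= zx; move: absorbing_start; rewrite zx ax.
rewrite [ltRHS]hitting_timeNy => [|m Xm].
  apply: (@le_lt_trans _ _ (n%:R)%:E); last exact: ltry.
  by apply: ereal_inf_lbound; exists n.
move/eqP: xy; apply; have [nm|/ltnW mn] := leqP n m.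
  by rewrite -Xm -Xn; apply/esym/reset_walk_absorbed => //; rewrite Xn.
by rewrite -Xm -Xn; apply/reset_walk_absorbed => //; rewrite Xm.
Qed.

(** Off the event the walk never visits [x], so its hitting time is [+oo] and the discount already
    vanishes. *)
Lemma discount_hitting_time_indic (s : R) (x y : R) w :
  absorbing a x -> absorbing a y -> x != y ->
  discount s (hitting_time X x w) *
    \1_[set w' | (hitting_time X x w' < hitting_time X y w')%E] w =
  discount s (hitting_time X x w).
Proof.
move=> ax ay xy; rewrite hitting_time_lt // indicE.
have [_|nX] := boolP (w \in _); first by rewrite mulr1.
rewrite hitting_timeNy ?mul0r // => n Xn.
by move/negP: nX; apply; rewrite inE; exists n.
Qed.

End reset_walk_paths.

Lemma measurable_reset_walk {d : measure_display} {T : measurableType d}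
    {R : realType} (xi : nat -> T -> R) (rho : nat -> T -> bool) (a z n : nat) :
  (forall n, measurable_fun setT (xi n)) ->
  (forall n, measurable_fun setT (rho n)) ->
  measurable_fun setT (reset_walk xi rho a z n).
Proof.
move=> mxi mrho; elim: n => [|n IHn]; first exact: measurable_cst.
apply: measurable_fun_ifT => //.
  by apply: measurable_or; apply: measurable_fun_eqr.
apply: measurable_fun_ifT => //.
exact: measurable_funD.
Qed.
(** * Transition probabilities of the walk with resetting *)

Section resetting_chain.
Variables (a z : nat).
Hypothesis hz : (0 < z < a)%N.

Definition alive (x : 'I_a.+1) : bool := (0 < x < a)%N.

(** Meaningful on [alive] sites only; at the ends, truncated subtraction and the default of [inord]
    give values without probabilistic meaning. *)
Definition site_step (x : 'I_a.+1) (up : bool) : 'I_a.+1 :=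
  inord (if up then x.+1 else x.-1).

(* One step driven by c = (reset decision, step upwards); the flag r switches
   resetting on. *)
Definition site_move (r : bool) (x : 'I_a.+1) (c : bool * bool) : 'I_a.+1 :=
  if alive x then if r && c.1 then inord z else site_step x c.2 else x.

Lemma site_stepE x (up : bool) : alive x ->
  site_step x up = (if up then x.+1 else x.-1) :> nat.
Proof.
move=> /andP[x0 xa]; rewrite inordK //; case: up => //.
by rewrite ltnS (leq_trans (leq_pred _)) // -ltnS ltn_ord.
Qed.

Lemma alive_start : alive (inord z).
Proof. by rewrite /alive inordK //; case/andP: hz => _ /ltnW. Qed.

Lemma absorbing_site {R : realType} (x : 'I_a.+1) :
  absorbing a (x%:R : R) = ~~ alive x.
Proof.
rewrite /absorbing /alive pnatr_eq0 eqr_nat negb_and -eqn0Ngt -leqNgt.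
by congr orb; rewrite eqn_leq -ltnS ltn_ord.
Qed.

(** With steps [1] and [- 1] the real-valued walk never leaves the integers from 0 to [a], because
    it moves only from interior sites. This reduces paths to a chain on a finite type. *)
Lemma reset_walk_chain {T : Type} {R : realType} (xi : nat -> T -> R)
    (rho : nat -> T -> bool) (r : bool) n w :
  (forall n, xi n w = 1 \/ xi n w = - 1) ->
  reset_walk xi (fun n w => r && rho n w) a z n w =
  (chain (fun n w => (rho n w, xi n w == 1)) (site_move r) (inord z) n w)%:R.
Proof.
move=> xi1; elim: n => [|n IHn] /=.
  by rewrite inordK //; case/andP: hz => _ /ltnW.
rewrite {}IHn absorbing_site; set x := chain _ _ _ _ _.
rewrite /site_move; case: ifPn => [/negbTE -> //|/negPn ax]; rewrite ax /=.
case: ifP => _; first by rewrite inordK //; case/andP: hz => _ /ltnW.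
rewrite site_stepE //; have [->|->] := xi1 n; first by rewrite eqxx natr1.
rewrite eq_sym -subr_eq0 opprK (_ : 1 + 1 = 2%:R) // pnatr_eq0 /=.
by case/andP: ax => x0 _; rewrite -[in LHS](prednK x0) -natr1 addrK.
Qed.

Section law.
Context {R : realType}.
Variables (p gamma : R).
Hypothesis hp : 0 < p < 1.
Hypothesis hgamma : 0 < gamma < 1.

Definition outcome_law (c : bool * bool) : R :=
  (if c.1 then gamma else 1 - gamma) * (if c.2 then p else 1 - p).

Definition step_law (x y : 'I_a.+1) : R :=
  p * (site_step x true == y)%:R + (1 - p) * (site_step x false == y)%:R.

Definition site_law (r : bool) : nat -> 'I_a.+1 -> R :=
  chain_law outcome_law (site_move r) (inord z).

Let p_ge0 : 0 <= p. Proof. by have /andP[/ltW] := hp. Qed.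
Let q_gt0 : 0 < 1 - p. Proof. by rewrite subr_gt0; have /andP[] := hp. Qed.
Let s_gt0 : 0 < 1 - gamma.
Proof. by rewrite subr_gt0; have /andP[] := hgamma. Qed.
Let gamma_ge0 : 0 <= gamma. Proof. by have /andP[/ltW] := hgamma. Qed.

Lemma step_law_ge0 x y : 0 <= step_law x y.
Proof. by rewrite addr_ge0 // mulr_ge0 // ltW. Qed.

Lemma sum_step_law_le1 (A : pred 'I_a.+1) x : \sum_(y | A y) step_law x y <= 1.
Proof.
have le1 c : \sum_(y | A y) (site_step x c == y)%:R <= 1 :> R.
  rewrite -natr_sum lern1 -big_mkcondr sum1dep_card.
  apply: leq_trans (_ : #|pred1 (site_step x c)| <= 1)%N; last by rewrite card1.
  by apply/subset_leq_card/fintype.subsetP => y; rewrite !inE eq_sym => /andP[].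
rewrite big_split /= -!mulr_sumr.
apply: (@le_trans _ _ (p * 1 + (1 - p) * 1)); last by rewrite !mulr1 subrKC.
by apply: lerD; apply: ler_wpM2l => //; exact: ltW.
Qed.

Definition move_law (r : bool) (x y : 'I_a.+1) : R :=
  if r then (1 - gamma) * step_law x y + gamma * (y == inord z)%:R
  else step_law x y.

Lemma move_law_ge0 r x y : 0 <= move_law r x y.
Proof.
rewrite /move_law; case: r; last exact: step_law_ge0.
by rewrite addr_ge0 // mulr_ge0 // ?step_law_ge0 // ltW.
Qed.

(** Split by the previous site: an absorbing one keeps its mass, as the outcome probabilities add up
    to 1, and from an interior one the four outcomes combine into [move_law]. *)
Lemma site_lawS r n y :
  site_law r n.+1 y = (~~ alive y)%:R * site_law r n y +
                      \sum_(x | alive x) site_law r n x * move_law r x y.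
Proof.
rewrite [LHS]/= (bigID alive) /= addrC; congr (_ + _).
  have sum1 : \sum_c outcome_law c = 1.
    rewrite -(pair_bigA _ (fun i j => outcome_law (i, j))) /= !big_bool /=.
    by rewrite /outcome_law /=; ring.
  under eq_bigr => x nax.
    under eq_bigr do rewrite /site_move (negbTE nax).
    by rewrite -mulr_suml sum1 mul1r; over.
  have [ay|nay] := boolP (alive y).
    rewrite mul0r big1 // => x nax; case: eqVneq => [xy|]; last by rewrite mulr0.
    by rewrite xy ay in nax.
  rewrite (bigD1 y) //= eqxx mulr1 mul1r big1 ?addr0 // => x /andP[_ /negbTE ->].
  by rewrite mulr0.
apply: eq_bigr => x ax; congr (_ * _).
rewrite -(pair_bigA _ (fun i j => outcome_law (i, j) *
  (site_move r x (i, j) == y)%:R)) /= !big_bool /=.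
rewrite /outcome_law /site_move ax /= /move_law /step_law.
by case: r => /=; rewrite ?[inord z == y]eq_sym; ring.
Qed.

Hypothesis law_ge0 : forall n x, 0 <= site_law true n x.
Hypothesis law_le1 : forall n x, site_law true n x <= 1.

(* Every visit to x > 0 leads to x - 1 with probability s q, so bounds on the
   number of visits propagate upwards from the site 0, which is entered at most
   once. *)
Lemma bounded_visits (k : nat) (x : 'I_a.+1) : x = k :> nat -> alive x ->
  exists B : R, forall n, series (site_law true ^~ x) n <= B.
Proof.
pose s := 1 - gamma; have sq0 : 0 < s * (1 - p) by rewrite mulr_gt0.
have move_down (x' y : 'I_a.+1) n : alive x' -> y.+1 = x' :> nat ->
    s * (1 - p) * site_law true n x' <=
    \sum_(x | alive x) site_law true n x * move_law true x y.
  move=> ax' yx'; rewrite (bigD1 x') // mulrC ler_wpDr //.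
    by apply: sumr_ge0 => i _; rewrite mulr_ge0 ?move_law_ge0.
  apply: ler_wpM2l => //; rewrite /move_law /step_law.
  have -> : site_step x' false == y.
    by apply/eqP/ord_inj; rewrite site_stepE //= -yx'.
  rewrite mulr1 -/s ler_wpDr ?mulr_ge0 // ler_wpM2l ?(ltW s_gt0) //.
  by rewrite ler_wpDl ?mulr_ge0.
elim: k x => [|k IHk] x xk ax; first by move: ax; rewrite /alive xk.
suff [B hB] : exists B, forall n,
    s * (1 - p) * series (site_law true ^~ x) n <= B.
  by exists ((s * (1 - p))^-1 * B) => n; rewrite ler_pdivlMl.
have ka : (k < a.+1)%N by rewrite ltnW // -xk ltn_ord.
pose y := Ordinal ka.
have [k0|k0] := posnP k.
  have nay : ~~ alive y by rewrite /alive /= k0.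
  (* The mass at site 0 only grows, at each step by at least [s * (1 - p)] times the mass at site 1;
     being a probability, it bounds the sum by 1. *)
  exists 1 => n; apply: le_trans (law_le1 n y).
  elim: n => [|n IHn]; first by rewrite /series /= big_geq // mulr0 ler0n.
  rewrite site_lawS nay mul1r /series /= big_nat_recr //= mulrDr.
  by apply: lerD => //; apply: move_down; rewrite // xk.
have ay : alive y.
  rewrite /alive /= k0 /=; move: (ltn_ord x); rewrite xk ltnS.
  exact: leq_trans.
have [B hB] := IHk y erefl ay.
(* A visit to [x] at time [i] is charged to [y] at time [i.+1], hence one more term in the sum for
   [y]. *)
exists B => n; apply: le_trans (hB n.+1).
rewrite /series /= big_nat_recl // mulr_sumr ler_wpDl //.
apply: ler_sum => i _; rewrite site_lawS ay mul0r add0r.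
by apply: move_down; rewrite // xk.
Qed.

Lemma cvg_visits x : alive x -> cvgn (series (site_law true ^~ x)).
Proof.
move=> ax; have [B hB] := bounded_visits _ x erefl ax.
apply: nondecreasing_is_cvgn; first exact: nondecreasing_series.
by exists B => _ [n _ <-].
Qed.

End law.
End resetting_chain.
(** * Independence of the outcomes *)

Lemma cylinderE {T : Type} {O : finType} (o : nat -> T -> O) (c0 : O) n e :
  cylinder o n e =
  \big[setI/setT]_(k < size e) [set w | o (n + k)%N w = nth c0 e k].
Proof.
elim: e n => [|c e IHe] n /=; first by rewrite big_ord0.
rewrite big_ord_recl /= addn0 IHe; congr (_ `&` _).
by apply: eq_bigr => k _; rewrite addSnnS.
Qed.

Section independent_outcomes.
Context {d : measure_display} {T : measurableType d} {R : realType}.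
Variables (P : probability T R) (p gamma : R).
Variables (xi : nat -> {RV P >-> R}) (rho : nat -> {RV P >-> bool}).

Definition outcome (n : nat) (w : T) : bool * bool := (rho n w, xi n w == 1).

Lemma measurable_up n b : measurable [set w | (xi n w == 1) = b].
Proof.
have m1 : measurable (xi n @^-1` [set 1]).
  by rewrite -[X in measurable X]setTI; apply: measurable_funP.
case: b.
  by rewrite (_ : [set _ | _] = xi n @^-1` [set 1]) //;
    apply/seteqP; split=> w /= /eqP.
rewrite (_ : [set _ | _] = ~` (xi n @^-1` [set 1])).
  exact: measurableC.
by apply/seteqP; split=> w /=; [move/negbT/eqP|move/eqP/negbTE].
Qed.

Lemma measurable_reset n b : measurable [set w | rho n w = b].
Proof.
rewrite -[X in measurable X]setTI (_ : [set w | _] = rho n @^-1` [set b]) //.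
exact: measurable_funP.
Qed.

Lemma measurable_outcome n c : measurable [set w | outcome n w = c].
Proof.
rewrite (_ : [set _ | _] =
    [set w | rho n w = c.1] `&` [set w | (xi n w == 1) = c.2]).
  by apply: measurableI; [exact: measurable_reset|exact: measurable_up].
by case: c => r b; rewrite /outcome; apply/seteqP; split=> w /= [-> ->].
Qed.

Hypothesis xi_up : forall n, P [set w | xi n w = 1] = p%:E.
Hypothesis rho_reset : forall n, P [set w | rho n w = true] = gamma%:E.
Hypothesis indep : mutually_independent P
  (steps_and_resets (fun n => xi n) (fun n => rho n)).

(** A word of pairs constrains finitely many steps and resets; mutual independence is applied once
    to the list of all these indices, and the factors are then regrouped by time. *)
Lemma outcome_cylinderP e :
  P (cylinder outcome 0 e) = (\prod_(c <- e) outcome_law p gamma c)%:E.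
Proof.
pose c k := nth (true, true) e k.
pose A (i : nat + nat) : set T :=
  match i with
  | inl k => [set w | (xi k w == 1) = (c k).2]
  | inr k => [set w | rho k w = (c k).1]
  end.
pose s := [seq inl k | k <- index_iota 0 (size e)] ++
          [seq inr k | k <- index_iota 0 (size e)] : seq (nat + nat).
have us : uniq s.
  rewrite cat_uniq !map_inj_uniq ?iota_uniq => [|? ? []|? ? []] //=.
  by rewrite andbT; apply/hasPn => _ /mapP[k _ ->]; apply/mapP => -[].
have -> : cylinder outcome 0 e = \big[setI/setT]_(i <- s) A i.
  rewrite (cylinderE _ (true, true)) big_cat /= !big_map -big_split /=.
  rewrite big_mkord.
  apply: eq_bigr => k _; rewrite add0n setIC /outcome -/(c k).
  by case: (c k) => r b; apply/seteqP; split=> w /= [-> ->].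
rewrite (mutually_independent_seq _ _ _ _ _ indep us); last first.
  case=> k _ /=.
    (* A step down is recorded as the failure of [xi k w == 1], so its event is the preimage of a
       complement, and its probability [1 - p] is obtained below from [xi_up]. *)
    exists (if (c k).2 then [set 1] else ~` [set 1]).
      by case: ifP => _; [|apply: measurableC]; exact: measurable_set1.
    rewrite setTI; apply/seteqP; split=> w /=; case: ((c k).2) => /=.
    - by move=> ->; rewrite eqxx.
    - by move=> /eqP/negbTE.
    - by move/eqP.
    - by move=> /negbT/eqP.
  by exists [set (c k).1] => //; rewrite setTI.
have PA k : (P (A (inr k)) * P (A (inl k)))%E = (outcome_law p gamma (c k))%:E.
  rewrite EFinM; congr (_ * _)%E => /=.
    case: ((c k).1) => //.
    rewrite EFinB -(rho_reset k) -probability_setC; last exact: measurable_reset.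
    by congr (P _); apply/seteqP; split=> w /=; case: (rho k w).
  have mu := measurable_up k true.
  have upE : [set w | (xi k w == 1) = true] = [set w | xi k w = 1].
    by apply/seteqP; split=> w /= /eqP.
  case: ((c k).2); first by rewrite upE.
  rewrite EFinB -(xi_up k) -upE -probability_setC //.
  by congr (P _); apply/seteqP; split=> w /=; case: (xi k w == 1).
rewrite big_cat /= !big_map -big_split /=.
under eq_bigr do rewrite muleC PA.
by rewrite prodEFin; congr _%:E; rewrite [RHS](big_nth (true, true)).
Qed.

End independent_outcomes.

(** * Laws of the walks with and without resetting *)

Section resetting_law.
Context {d : measure_display} {T : measurableType d} {R : realType}.
Variables (P : probability T R) (a z : nat) (p gamma : R).
Variables (xi : nat -> {RV P >-> R}) (rho : nat -> {RV P >-> bool}).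
Hypothesis hz : (0 < z < a)%N.
Hypothesis xi_up : forall n, P [set w | xi n w = 1] = p%:E.
Hypothesis xi_down : forall n, P [set w | xi n w = - 1] = (1 - p)%:E.
Hypothesis rho_reset : forall n, P [set w | rho n w = true] = gamma%:E.
Hypothesis indep : mutually_independent P
  (steps_and_resets (fun n => xi n) (fun n => rho n)).

Local Notation law := (site_law a z p gamma).

(** For each [n] the disjoint values [1] and [- 1] carry total mass [p + (1 - p) = 1]; a countable
    union of null sets is null. *)
Lemma negligible_bad_steps :
  P.-negligible (~` [set w | forall n, xi n w = 1 \/ xi n w = - 1]).
Proof.
have -> : ~` [set w | forall n, xi n w = 1 \/ xi n w = - 1] =
    \bigcup_n ~` [set w | xi n w = 1 \/ xi n w = - 1].
  apply/seteqP; split=> w /=; first by move/existsNP => -[n nw]; exists n.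
  by move=> [n _ /= nw] /(_ n).
apply: negligible_bigcup => n.
have mxi x : measurable [set w | xi n w = x].
  rewrite -[X in measurable X]setTI (_ : [set w | _] = xi n @^-1` [set x]) //.
  exact: measurable_funP.
have mU : measurable [set w | xi n w = 1 \/ xi n w = - 1].
  exact: (measurableU _ _ (mxi 1) (mxi (- 1))).
apply/negligibleP; first exact: measurableC.
pose U : set T := [set w | xi n w = 1] `|` [set w | xi n w = - 1].
transitivity (1 - P U)%E; first exact: probability_setC.
rewrite measureU //; first last.
  apply/seteqP; split=> // w /= [-> ] /eqP.
  by rewrite -subr_eq0 opprK (_ : 1 + 1 = 2%:R) // pnatr_eq0.
have -> : (P [set w | xi n w = 1%R] + P [set w | xi n w = (- 1)%R] = 1%:E)%E.
  by rewrite xi_up xi_down -EFinD subrKC.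
exact: subee.
Qed.

Lemma site_lawP r n (x : 'I_a.+1) :
  P [set w | chain (outcome P xi rho) (site_move a z r) (inord z) n w = x] =
  (law r n x)%:E.
Proof.
apply: chain_lawE; last exact: outcome_cylinderP.
exact: measurable_outcome.
Qed.

Lemma measurable_site r n (x : 'I_a.+1) : measurable
  [set w | chain (outcome P xi rho) (site_move a z r) (inord z) n w = x].
Proof. by apply: measurable_chain; exact: measurable_outcome. Qed.

Lemma site_law_ge0 r n x : 0 <= law r n x.
Proof. by rewrite -lee_fin -site_lawP. Qed.

Lemma site_law_le1 r n x : law r n x <= 1.
Proof.
by rewrite -lee_fin -site_lawP probability_le1 //; exact: measurable_site.
Qed.

(** [r = true] gives the walk with resetting, [r = false] the plain walk on the same probability
    space. *)
Local Notation X r := (reset_walk (fun n => xi n) (fun n w => r && rho n w) a z).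

Lemma measurable_walk r n : measurable_fun setT (X r n).
Proof.
apply: measurable_reset_walk => k; first exact: measurable_funP.
apply: measurable_and; first exact: measurable_cst.
exact: measurable_funP.
Qed.

Lemma measurable_walk_at r n (x : R) : measurable [set w | X r n w == x].
Proof.
rewrite -[V in measurable V]setTI.
rewrite (_ : [set w | _] = X r n @^-1` [set x]).
  by apply: measurable_walk.
by apply/seteqP; split=> w /= /eqP.
Qed.

Lemma walk_law r n (x : 'I_a.+1) :
  P [set w | X r n w == x%:R] = (law r n x)%:E.
Proof.
rewrite -site_lawP; apply: (measure_eq_outside_negligible _ _ _ _ negligible_bad_steps).
- exact: measurable_walk_at.
- exact: measurable_site.
- move=> w /= /contrapT good; rewrite reset_walk_chain // eqr_nat.
  by split=> [/eqP/ord_inj|->].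
Qed.

Lemma measurable_absorbed r n : measurable [set w | absorbing a (X r n w)].
Proof.
rewrite (_ : [set w | _] =
    [set w | X r n w == 0] `|` [set w | X r n w == a%:R]).
  by apply: measurableU; exact: measurable_walk_at.
by apply/seteqP; split=> w /=; rewrite /absorbing => /orP.
Qed.

Lemma absorbed_law r n :
  P [set w | absorbing a (X r n w)] = (law r n ord0 + law r n ord_max)%:E.
Proof.
have a0 : (0 < a)%N by case/andP: hz => /ltn_trans; apply.
rewrite (_ : [set w | _] =
    [set w | X r n w == 0] `|` [set w | X r n w == a%:R]); last first.
  by apply/seteqP; split=> w /=; rewrite /absorbing => /orP.
rewrite measureU; [|exact: measurable_walk_at|exact: measurable_walk_at|].
  by rewrite EFinD -!walk_law.
apply/seteqP; split=> // w /= [/eqP -> /eqP/esym/eqP].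
by rewrite pnatr_eq0 eqn0Ngt a0.
Qed.

End resetting_law.

(** * The ruin probability as a ratio of discounted fluxes *)

Theorem mainTheorem3 (R : realType) (d : measure_display)
    (T : measurableType d) (P : probability T R)
    (a z : nat) (hz : (0 < z < a)%N)
    (p q gamma : R) (hp : 0 < p < 1) (hq : q = 1 - p) (hgamma : 0 < gamma < 1)
    (xi : nat -> {RV P >-> R}) (rho : nat -> {RV P >-> bool})
    (xi_up : forall n, P [set w | xi n w = 1] = p%:E)
    (xi_down : forall n, P [set w | xi n w = - 1] = q%:E)
    (rho_reset : forall n, P [set w | rho n w = true] = gamma%:E)
    (indep : mutually_independent P
               (steps_and_resets (fun n => xi n) (fun n => rho n))) :
  let Y := walk (fun n => xi n) a z in
  let tau0 := hitting_time Y 0 in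
  let taua := hitting_time Y a%:R in
  let tau : T -> \bar R := fun w => mine (tau0 w) (taua w) in
  (ruin_probability P (fun n => xi n) (fun n => rho n) a z =
     'E_P[fun w => (discount (1 - gamma) (tau0 w)
                    * \1_[set w' | (tau0 w' < taua w')%E] w)%R]
     / 'E_P[fun w => discount (1 - gamma) (tau w)])%E.
Proof.
move=> Y tau0 taua tau.
have a0 : (0 < a)%N by case/andP: hz => /ltn_trans; apply.
rewrite hq in xi_down.
pose X r := reset_walk (fun n => xi n) (fun n w => r && rho n w) a z.
pose law r := site_law a z p gamma r.
have YE : Y = X false by rewrite /Y walkE.
have [p_gt0 p_lt1] := andP hp; have [gamma_gt0 gamma_lt1] := andP hgamma.
pose s := 1 - gamma.
have s_gt0 : 0 < s by rewrite subr_gt0.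
have s_ge0 := ltW s_gt0.
have s_lt1 : s < 1 by rewrite gtrBl.
have law_ge0 r n x : 0 <= law r n x by apply: site_law_ge0.
have law_le1 r n x : law r n x <= 1 by apply: site_law_le1.
have law0 r x : law r 0%N x = (x == inord z)%:R by [].
have lawS r n y : law r n.+1 y = (~~ alive a y)%:R * law r n y +
    \sum_(x | alive a x) law r n x * move_law a z p gamma r x y by exact: site_lawS.
pose K := step_law a p.
have [c [U [c_gt0 uU vV]]] : exists (c : R) (U : 'I_a.+1 -> R), [/\ 0 < c,
    forall x, alive a x ->
      series (fun n => s ^+ n * law false n x) n @[n --> \oo] --> U x &
    forall x, alive a x ->
      series (law true ^~ x) n @[n --> \oo] --> c * U x].
  apply: (@reset_occupation R _ (alive a) K s (inord z)) => //.
  - exact: alive_start.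
  - by rewrite s_ge0.
  - by move=> x y; apply: step_law_ge0.
  - by move=> x; apply: sum_step_law_le1.
  - by move=> n y ay; rewrite lawS ay mul0r add0r.
  - move=> n y ay; rewrite lawS ay mul0r add0r; apply: eq_bigr => x _.
    by rewrite /s subKr.
  - by move=> n x; rewrite law_ge0 law_le1.
  - by move=> x ax; apply: cvg_visits.
(* The discounted flux into [y]; for [y] absorbing this is the [F_y] of the overview. *)
pose f y := \sum_(x | alive a x) U x * (s * K x y).
have dead_start y : ~~ alive a y -> (y == inord z) = false.
  by move=> ny; apply: contraNF ny => /eqP ->; exact: alive_start.
have entry_cvg y : ~~ alive a y ->
    series (fun n => s ^+ n.+1 * (law false n.+1 y - law false n y)) n
      @[n --> \oo] --> f y.
  (* [g 0 = 0] since the walk does not start at an absorbing site; the index shift matches the entry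
     time [n.+1] with the exponent of [s]. *)
  move=> ny; pose g n := if n is m.+1 then
    s ^+ m.+1 * (law false m.+1 y - law false m y) else 0.
  have := @cvg_series_transfer R _ (alive a) (fun n x => s ^+ n * law false n x)
    U (fun x => s * K x y) g.
  rewrite add0r => /(_ _ uU) H.
  have {}H : series g n @[n --> \oo] --> f y.
    apply: H => n; rewrite /g lawS ny mul1r addrC addKr exprS mulr_sumr.
    by apply: eq_bigr => x _; rewrite /K /=; ring.
  move: H; rewrite -(cvg_shiftS (series g)); apply: cvg_trans.
  by apply: near_eq_cvg; apply: nearW => n; rewrite /series /= big_nat_recl //= add0r.
(* The increments of [law true n y] telescope from 0. Resets lead to [z] and not to [y], so only
   steps, with weight [s * K x y], feed the absorbing site. *)
have reset_cvg y : ~~ alive a y -> law true n y @[n --> \oo] --> c * f y.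
  move=> ny; pose g n := if n is m.+1 then law true m.+1 y - law true m y else 0.
  have := @cvg_series_transfer R _ (alive a) (law true)
    (fun x => c * U x) (fun x => s * K x y) g.
  rewrite add0r => /(_ _ vV) H.
  have {}H : series g n @[n --> \oo] --> c * f y.
    rewrite /f mulr_sumr; under eq_bigr do rewrite mulrA.
    apply: H => n; rewrite /g lawS ny mul1r addrC addKr; apply: eq_bigr => x _.
    by rewrite /move_law (dead_start y ny) mulr0 addr0.
  move: H; rewrite -(cvg_shiftS (series g)); apply: cvg_trans.
  apply: near_eq_cvg; apply: nearW => n; rewrite /series /= big_nat_recl //= add0r.
  by rewrite telescope_sumr // law0 dead_start // subr0.
have n0 : ~~ alive a ord0 by [].
have na : ~~ alive a ord_max by rewrite /alive /= ltnn andbF.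
(* Almost sure absorption: the terms of the convergent visit series tend to 0, so the mass on
   interior sites vanishes and the mass on the two ends tends to 1. *)
have absorbed : c * (f ord0 + f ord_max) = 1.
  have sum0 : \sum_(x | alive a x) law true n x @[n --> \oo] --> (0 : R).
    have := @cvg_fin_sum R _ (alive a) (fun x n => law true n x) (fun=> 0).
    rewrite big1_eq; apply=> x ax; apply: (@cvg_series_cvg_0 _ R^o).
    by apply/cvg_ex; exists (c * U x); exact: vV.
  have lawD n : law true n ord0 + law true n ord_max =
      1 - \sum_(x | alive a x) law true n x.
    rewrite -(@sum_chain_law _ T R _ _ P (outcome P xi rho)
      (outcome_law p gamma) (site_move a z true) (inord z) _ _ n); last 2 first.
    - exact: measurable_outcome.
    - exact: outcome_cylinderP.
    rewrite (bigID (alive a)) /= addrC addrK.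
    rewrite (bigD1 ord0) //= (bigD1 ord_max) /=; last first.
      by rewrite na -val_eqE /= -lt0n.
    (* No site other than 0 and [a] is absorbing. *)
    rewrite big1 ?addr0 // => x /andP[/andP[nx x0] xa]; exfalso; move: nx.
    rewrite /alive lt0n -[(x : nat) == 0%N]/(x == ord0) x0 /= ltn_neqAle.
    by rewrite -[(x : nat) == a]/(x == ord_max) xa -ltnS ltn_ord.
  have l1 : law true n ord0 + law true n ord_max @[n --> \oo] -->
      c * f ord0 + c * f ord_max by apply: cvgD; exact: reset_cvg.
  have l2 : law true n ord0 + law true n ord_max @[n --> \oo] --> (1 - 0 : R).
    under eq_cvg do rewrite lawD.
    by apply: cvgB => //; exact: cvg_cst.
  rewrite mulrDr -[RHS]subr0.
  exact: (cvg_unique (@Rhausdorff R) l1 l2).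
have a0R : (0 : R) != a%:R by rewrite eq_sym pnatr_eq0 -lt0n.
have abs0 : absorbing a (0 : R) by rewrite /absorbing eqxx.
have absa : absorbing a (a%:R : R) by rewrite /absorbing eqxx orbT.
have Xz r w : ~~ absorbing a (X r 0%N w) by exact: absorbing_start.
have ruinE : ruin_probability P (fun n => xi n) (fun n => rho n) a z =
    (c * f ord0)%:E.
  rewrite /ruin_probability hitting_time_lt //.
  have mX n : measurable [set w | X true n w = 0].
    rewrite (_ : [set w | _] = [set w | X true n w == 0]).
      exact: measurable_walk_at.
    by apply/seteqP; split=> w /= /eqP.
  (* Absorption makes these events increase with [n], so continuity from below applies. *)
  have /cvg_lim <- // : (P [set w | X true n w = 0]) @[n --> \oo] -->
      P (\bigcup_n [set w | X true n w = 0]).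
    apply: nondecreasing_cvg_mu => //; first exact: bigcupT_measurable.
    move=> m n mn; apply/subsetPset => w /= Xm.
    rewrite -[RHS]Xm; apply: (@reset_walk_absorbed) => //.
    by rewrite -/(X true) Xm.
  apply/cvg_lim => //.
  have -> : (fun n => P [set w | X true n w = 0]) =
      (fun n => (law true n ord0)%:E).
    apply/funext => n; rewrite /law -(walk_law _ _ _ _ _ xi rho) //.
    by congr (P _); apply/seteqP; split=> w /= /eqP.
  by apply: cvg_EFin; [exact: nearW|exact: reset_cvg].
have tau0E : 'E_P[fun w => (discount s (tau0 w)
      * \1_[set w' | (tau0 w' < taua w')%E] w)%R]%E = (f ord0)%:E.
  have -> : (fun w => (discount s (tau0 w)
      * \1_[set w' | (tau0 w' < taua w')%E] w)%R) =
      (fun w => discount s (entry_time (fun n => X false n w == 0))).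
    apply/funext => w; rewrite /tau0 /taua YE discount_hitting_time_indic //.
    by rewrite hitting_time_entry.
  apply: (@expectation_discount_entry_time _ _ _ _ _
    (fun w n => X false n w == 0) (fun n => law false n ord0)) => //.
  - by move=> n; apply: measurable_walk_at.
  - by move=> w n; apply: reset_walk_stay.
  - by move=> w; have := Xz false w; rewrite negb_or => /andP[].
  - by move=> n; rewrite /law -(walk_law _ _ _ _ _ xi rho).
  - exact: entry_cvg.
have tauE : 'E_P[fun w => discount s (tau w)]%E = (f ord0 + f ord_max)%:E.
  have -> : (fun w => discount s (tau w)) =
      (fun w => discount s (entry_time (fun n => absorbing a (X false n w)))).
    by apply/funext => w; rewrite /tau /tau0 /taua YE min_hitting_time_entry.
  apply: (@expectation_discount_entry_time _ _ _ _ _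
    (fun w n => absorbing a (X false n w))
    (fun n => law false n ord0 + law false n ord_max)) => //.
  - by move=> n; apply: measurable_absorbed.
  - by move=> w n aX; rewrite /X (@reset_walk_absorbed _ _ _ _ _ _ n).
  - by move=> n; apply: absorbed_law.
  - apply: cvg_trans (cvgD (entry_cvg _ n0) (entry_cvg _ na)).
    apply: near_eq_cvg; apply: nearW => n.
    rewrite /series fctE /= -big_split.
    by apply: eq_bigr => k _ /=; ring.
rewrite ruinE tau0E tauE.
(* With a nonzero denominator the inverse in [\bar R] is the real one, and [c] is eliminated through
   [absorbed]. *)
have F_neq0 : f ord0 + f ord_max != 0.
  by apply: contra_eq_neq absorbed => ->; rewrite mulr0 eq_sym oner_eq0.
rewrite inver (negbTE F_neq0) -EFinM; congr _%:E.
by apply: (mulIf F_neq0); rewrite divfK // mulrAC absorbed mul1r.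
Qed.
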